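(* Let $\beta$ be a complex number such that $|\beta|>1$. There exist a finite alphabet $\mathcal{A}\subset\mathbb{Z}[\beta]$ with $0\in\mathcal{A}$ and $1\in\operatorname{Fin}_{\mathcal{A}}(\beta)$ and a positive integer $k$ such that $(\beta,\mathcal{A})$ allows $k$-block parallel addition, if and only if $\beta$ is an algebraic number with no conjugate of modulus $1$. If this is the case, then there also exists an alphabet contained in $\mathbb{Z}$ allowing $1$-block parallel addition in base $\beta$.
   Context: $\mathbb{N}$ contains $0$. $\mathbb{Z}[\beta]$ is the smallest ring containing $\mathbb{Z}$ and $\beta$, i.e. the set of all finite sums $\sum_{i=0}^N x_i\beta^i$ with $x_i\in\mathbb{Z}$. The conjugates of an algebraic number are all complex roots of its minimal polynomial over $\mathbb{Q}$ (including the number itself). A numeration system is a pair $(\beta,\mathcal{A})$ where $\beta\in\mathbb{C}$, $|\beta|>1$ (the base), and $\mathcal{A}\subset\mathbb{C}$ is a finite set containing $0$ (the alphabet). Define $\operatorname{Fin}_{\mathcal{A}}(\beta)=\{\sum_{j=-m}^n x_j\beta^j : n,m\in\mathbb{N},\ x_j\in\mathcal{A}\}$. For alphabets $\mathcal{A},\mathcal{B}$, a function $\varphi:\mathcal{B}^{\mathbb{Z}}\to\mathcal{A}^{\mathbb{Z}}$ is $p$-local if there exist $r,t\in\mathbb{N}$ with $p=r+t+1$ and a function $\phi:\mathcal{B}^p\to\mathcal{A}$ such that for every $w=(w_j)_{j\in\mathbb{Z}}\in\mathcal{B}^{\mathbb{Z}}$ its image $z=\varphi(w)=(z_j)_{j\in\mathbb{Z}}$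 satisfies $z_j=\phi(w_{j+t},\dots,w_{j-r})$ for all $j\in\mathbb{Z}$. A digit set conversion in base $\beta$ from $\mathcal{B}$ to $\mathcal{A}$ (alphabets containing $0$) is a function $\varphi:\mathcal{B}^{\mathbb{Z}}\to\mathcal{A}^{\mathbb{Z}}$ such that for every $w=(w_j)_{j\in\mathbb{Z}}\in\mathcal{B}^{\mathbb{Z}}$ with finitely many non-zero digits, $z=\varphi(w)$ has only finitely many non-zero digits and $\sum_{j\in\mathbb{Z}}w_j\beta^j=\sum_{j\in\mathbb{Z}}z_j\beta^j$. Parallel addition in $(\beta,\mathcal{A})$ is a digit set conversion in base $\beta$ from $\mathcal{A}+\mathcal{A}=\{a+a' : a,a'\in\mathcal{A}\}$ to $\mathcal{A}$ that is $p$-local for some $p\in\mathbb{N}$; $(\beta,\mathcal{A})$ allows parallel addition if such a function exists. For a positive integer $k$, $(\beta,\mathcal{A})$ allows $k$-block parallel addition if there exists parallel addition in $(\beta^k,\mathcal{A}_{(k)})$, where $\mathcal{A}_{(k)}=\{a_{k-1}\beta^{k-1}+\dots+a_1\beta+a_0 : a_i\in\mathcal{A}\}$. ($1$-block parallel addition is parallel addition.) *)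

(* Defs.v *)
From HB Require Import structures.
From mathcomp Require Import all_boot all_order all_algebra finmap.
From mathcomp Require Import boolp classical_sets cardinality fsbigop reals.
From mathcomp Require Import complex.

Set Implicit Arguments.
Unset Strict Implicit.
Unset Printing Implicit Defensive.

Import Order.TTheory GRing.Theory Num.Theory.
Local Open Scope ring_scope.
Local Open Scope complex_scope.

Definition minimal_polynomial (R : realType) (x : R[i]) (p : {poly rat}) : Prop :=
  [/\ p \is monic,
      root (map_poly ratr p) x
    & forall q : {poly rat}, q != 0 -> root (map_poly ratr q) x ->
        (size p <= size q)%N].

Definition conjugate (R : realType) (x y : R[i]) : Prop :=
  exists2 p : {poly rat}, minimal_polynomial x p & root (map_poly ratr p) y.

Definition Zring (R : realType) (beta : R[i]) : set R[i] :=
  [set z | exists p : {poly int}, z = (map_poly intr p).[beta]]%classic.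

Definition Fin (R : realType) (A : {fset R[i]}) (beta : R[i]) : set R[i] :=
  [set z | exists (m n : nat) (x : int -> A),
     z = \sum_(i < m + n + 1) val (x (i%:Z - m%:Z)) * beta ^ (i%:Z - m%:Z)]%classic.

(* The window is listed from its leftmost (highest) position w_(j+t) down to
   w_(j-r). *)
Definition local (A B : choiceType) (p : nat)
    (phi : (int -> B) -> (int -> A)) : Prop :=
  exists r t : nat, p = (r + t + 1)%N /\
    exists f : p.-tuple B -> A, forall (w : int -> B) (j : int),
      phi w j = f [tuple w (j + t%:Z - (i : nat)%:Z) | i < p].

Definition finite_word (R : realType) (A : {fset R[i]}) (w : int -> A) : Prop :=
  finite_set [set j | val (w j) != 0]%classic.

(* [\sum_(j \in setT)] is the sum over the support of the summand when that
   support is finite; it is only used on words satisfying [finite_word]. *)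
Definition word_value (R : realType) (beta : R[i]) (A : {fset R[i]})
    (w : int -> A) : R[i] :=
  \sum_(j \in [set: int]%classic) val (w j) * beta ^ j.

Definition digit_set_conversion (R : realType) (beta : R[i])
    (B A : {fset R[i]}) (phi : (int -> B) -> (int -> A)) : Prop :=
  forall w : int -> B, finite_word w ->
    finite_word (phi w) /\ word_value beta w = word_value beta (phi w).

Definition sum_alphabet (R : realType) (A : {fset R[i]}) : {fset R[i]} :=
  [fset (a + a')%R | a in A, a' in A]%fset.

Definition parallel_addition (R : realType) (beta : R[i]) (A : {fset R[i]}) : Prop :=
  exists phi : (int -> sum_alphabet A) -> (int -> A),
    digit_set_conversion beta phi /\ exists p : nat, local p phi.

Definition block_alphabet (R : realType) (beta : R[i]) (k : nat)
    (A : {fset R[i]}) : {fset R[i]} :=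
  [fset (\sum_(i < k) val (tnth a i) * beta ^+ i)%R | a : k.-tuple A]%fset.

Definition block_parallel_addition (R : realType) (beta : R[i]) (k : nat)
    (A : {fset R[i]}) : Prop :=
  parallel_addition (beta ^+ k) (block_alphabet beta k A).

(* Main.v *)
Require Import Defs.
From HB Require Import structures.
From mathcomp Require Import all_boot all_order all_algebra finmap.
From mathcomp Require Import boolp classical_sets cardinality fsbigop reals.
From mathcomp Require Import complex.
From mathcomp Require Import zify ring lra.

Set Implicit Arguments.
Unset Strict Implicit.
Unset Printing Implicit Defensive.

Import Order.TTheory GRing.Theory Num.Theory.
Local Open Scope ring_scope.
Local Open Scope complex_scope.

(** Both implications are about integer polynomial relations satisfied by [beta].

    Necessity.  Let [a] be a digit.  Starting from the one-letter word [a] and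
    adding the current word to itself [n] times in parallel gives a
    representation of [2 ^ n * a] whose length grows linearly in [n], because a
    local function widens the support by a constant ([doubling]).  The digits
    are integer polynomials in [beta], so this is an integer polynomial relation
    satisfied by [beta].  If [gamma] satisfies every such relation and has
    modulus 1, then the image of [2 ^ n * a] is bounded linearly in [n], hence
    the image of every digit vanishes; but 1 is a combination of digits
    ([specialization_unit_circle]).  The argument applies to a conjugate
    [gamma] of [beta], and to [gamma = 1] when [beta] is transcendental, since
    then the only relation is the trivial one.

    Sufficiency.  Let [z] run over the roots of the minimal polynomial.  The
    polynomial with roots [z ^ m], up to a scalar, is the product of the factors
    [1 - 'X / z ^ m] for [|z| > 1] and ['X - z ^ m] for [|z| < 1]; with no root
    on the circle, it tends to a monomial as [m] grows ([dominant_monomial]).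
    For [m] a power of 2 it has rational coefficients, by Graeffe's root squaring
    ([graeffe_iter]).  Clearing denominators gives an integer relation between
    powers of [beta] in which one coefficient is at least four times the sum of
    the absolute values of the others ([dominant_relation]).  Subtracting
    suitable multiples of the relation at every position at once then reduces
    all the digits, with carries that stay bounded
    ([dominant_parallel_addition]). *)

(** * Values of finitely supported words *)

Definition supported (V : nmodType) (K : nat) (u : int -> V) : Prop :=
  forall j : int, (K < `|j|)%N -> u j = 0.

(** [word_value b w] is by definition the value of the sequence of the digits of
    [w]; sequences in the field, unlike words, can be added, scaled and
    shifted. *)
Definition laurent_value (F : fieldType) (b : F) (u : int -> F) : F :=
  \sum_(j \in [set: int]%classic) u j * b ^ j.

Lemma supported_widen (V : nmodType) (K L : nat) (u : int -> V) :
  (K <= L)%N -> supported K u -> supported L u.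
Proof. by move=> KL uK j Lj; apply: uK; apply: leq_ltn_trans Lj. Qed.

Lemma finite_support_bounded (V : nmodType) (u : int -> V) :
  finite_set [set j | u j != 0]%classic -> exists K, supported K u.
Proof.
move=> /finite_seqP[s us]; exists (\max_(j <- s) `|j|)%N => j sj.
apply: contraTeq sj => uj; rewrite -leqNgt.
have : [set` s]%classic j by rewrite -us.
by move=> /= js; rewrite (big_rem j) //= leq_maxl.
Qed.

Lemma supported_finite (V : nmodType) (K : nat) (u : int -> V) :
  supported K u -> finite_set [set j | u j != 0]%classic.
Proof.
move=> uK; set s : seq int := [seq i%:Z - K%:Z | i <- iota 0 (K + K).+1].
suff us : forall j, u j != 0 -> j \in s.
  apply: (sub_finite_set (B := [set` s]%classic)); first exact: us.
  by apply/finite_seqP; exists s.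
move=> j; have [Kj|jK] := ltnP K `|j|; first by rewrite uK ?eqxx.
by move=> _; apply/mapP; exists `|(j + K%:Z)%R|%N; [rewrite mem_iota|]; lia.
Qed.

(** The sum over the support is traded for one over a symmetric window that
    does not depend on the word, so that words can be added and compared. *)
Lemma laurent_value_range (F : fieldType) (b : F) (K : nat) (u : int -> F) :
  supported K u ->
  laurent_value b u =
  \sum_(i < (K + K).+1) u (i%:Z - K%:Z) * b ^ (i%:Z - K%:Z).
Proof.
move=> uK; rewrite /laurent_value.
rewrite (fsbigE [seq i%:Z - K%:Z | i <- iota 0 (K + K).+1]).
- rewrite big_map (eq_bigl xpredT); last by move=> i; rewrite in_setT.
  by rewrite -[X in iota _ X]subn0 -/(index_iota 0 _) big_mkord.
- by rewrite map_inj_uniq ?iota_uniq // => i j; lia.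
- by [].
- move=> j _ jn; rewrite uK ?mul0r //; apply: contraNltn jn => jK.
  apply/mapP; exists `|(j + K%:Z)%R|%N; last by lia.
  by rewrite mem_iota; lia.
Qed.

Lemma laurent_valueD (F : fieldType) (b : F) (K : nat) (u v : int -> F) :
  supported K u -> supported K v ->
  laurent_value b (fun j => u j + v j) =
  laurent_value b u + laurent_value b v.
Proof.
move=> uK vK; rewrite !(laurent_value_range b (K := K)) // -?big_split /=.
  by apply: eq_bigr => i _; rewrite mulrDl.
by move=> j Kj; rewrite uK ?vK ?addr0.
Qed.

Lemma laurent_valueZ (F : fieldType) (b c : F) (u : int -> F) :
  laurent_value b (fun j => c * u j) = c * laurent_value b u.
Proof.
rewrite /laurent_value mulr_fsumr; apply: eq_fsbigr => j _; exact/esym/mulrA.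
Qed.

Lemma laurent_value_sum (F : fieldType) (b : F) (K : nat) (I : finType)
    (u : I -> int -> F) :
  (forall i, supported K (u i)) ->
  laurent_value b (fun j => \sum_i u i j) = \sum_i laurent_value b (u i).
Proof.
move=> uK; rewrite (laurent_value_range b (K := K)); last first.
  by move=> j Kj; rewrite big1 // => i _; apply: uK.
under eq_bigr do rewrite mulr_suml.
by rewrite exchange_big; apply: eq_bigr => i _; rewrite (laurent_value_range b (uK i)).
Qed.

Lemma laurent_value_shift (F : fieldType) (b : F) (h : int) (u : int -> F) :
  b != 0 ->
  laurent_value b (fun j => u (j + h)) = b ^ (- h) * laurent_value b u.
Proof.
move=> b0; rewrite /laurent_value mulr_fsumr.
rewrite [RHS](reindex_fsbigT (fun j => j + h)); last first.
  by exists (fun j => j - h) => j; rewrite ?addrK ?subrK.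
by apply: eq_fsbigr => j _; rewrite mulrCA -expfzDr //; congr (_ * b ^ _); lia.
Qed.

Lemma supported_shift (V : nmodType) (h : int) (K : nat) (u : int -> V) :
  supported K u -> supported (K + `|h|) (fun j => u (j + h)).
Proof. by move=> uK j Kj; apply: uK; lia. Qed.

(** * Doubling a digit in parallel *)

Definition digits (R : realType) (A : {fset R[i]}) (w : int -> A) : int -> R[i] :=
  fun j => val (w j).

(** Locality without its window: the image letter at a position is determined
    by the letters at distance at most [c], by the same rule everywhere. *)
Lemma local_eq (A B : choiceType) (p : nat) (phi : (int -> B) -> (int -> A)) :
  local p phi -> exists c : nat, forall (w w' : int -> B) (j j' : int),
    (forall h : int, (`|h| <= c)%N -> w (j + h) = w' (j' + h)) ->
    phi w j = phi w' j'.
Proof.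
move=> [r [t [-> [f phiE]]]]; exists (r + t)%N => w w' j j' ww'.
rewrite !phiE; congr f; apply: eq_from_tnth => i; rewrite !tnth_mktuple -!addrA.
by apply: ww'; have := ltn_ord i; lia.
Qed.

Lemma add_word_proof (R : realType) (A : {fset R[i]}) (w w' : int -> A)
    (j : int) :
  val (w j) + val (w' j) \in sum_alphabet A.
Proof. by apply: in_imfset2; apply: valP. Qed.

(** Words over [A] are added letter by letter, without carries; the result is a
    word over [A + A] to which a conversion applies. *)
Definition add_word (R : realType) (A : {fset R[i]}) (w w' : int -> A) :
  int -> sum_alphabet A := fun j => [` add_word_proof w w' j]%fset.

(** The image of the zero word is constant by locality and has finite support,
    so it is zero.  Away from the support a word looks like the zero word. *)
Lemma conversion_support (R : realType) (b : R[i]) (A : {fset R[i]})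
    (phi : (int -> sum_alphabet A) -> (int -> A)) (p : nat) :
  0 \in A -> digit_set_conversion b phi -> local p phi ->
  exists c : nat, forall (K : nat) (w : int -> sum_alphabet A),
    supported K (digits w) -> supported (K + c) (digits (phi w)).
Proof.
move=> A0 conv /local_eq[c phic]; exists c => K w wK j Kj.
pose z : int -> A := fun=> [` A0]%fset.
have [|phiz _] := conv (add_word z z).
  apply: (@supported_finite _ 0 (digits (add_word z z))) => i _.
  by rewrite /digits /= addr0.
(* Position [L + 1] lies outside the support of the constant image. *)
have [L zL] := @finite_support_bounded _ (digits (phi (add_word z z))) phiz.
rewrite /digits -(zL L.+1) //; congr val; apply: phic => h hc.
apply: val_inj; rewrite /= addr0; apply: wK; lia.
Qed.

(** Each step adds the word to itself, which keeps the support, and converts,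
    which widens it by a constant. *)
Lemma doubling (R : realType) (b : R[i]) (A : {fset R[i]}) (a : R[i]) :
  0 \in A -> a \in A -> parallel_addition b A ->
  exists c : nat, forall n : nat, exists z : int -> A,
    supported (c * n) (digits z) /\ laurent_value b (digits z) = 2 ^+ n * a.
Proof.
move=> A0 Aa [phi [conv [p phip]]].
have [c phic] := conversion_support A0 conv phip.
exists c; elim=> [|n [z [zn zE]]].
  pose z (j : int) : A := if j == 0 then [` Aa]%fset else [` A0]%fset.
  have z0 : supported (c * 0) (digits z).
    by move=> j; rewrite muln0 absz_gt0 /digits /z => /negPf->.
  exists z; split=> //; rewrite (laurent_value_range b z0) muln0 big_ord1.
  by rewrite expr0z mulr1 mul1r /digits /z eqxx.
exists (phi (add_word z z)).
have zz : supported (c * n) (digits (add_word z z)).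
  by move=> j jn; rewrite /digits /= -/(digits z j) zn ?addr0.
split; first by rewrite mulnS addnC; apply: phic.
have [_ wE] := conv (add_word z z) (supported_finite zz).
transitivity (laurent_value b (digits (add_word z z))); first exact/esym/wE.
by rewrite (laurent_valueD b zn zn) zE exprS; ring.
Qed.

Lemma nonpos_of_bounded_multiples (R : realType) (x y : R) :
  (forall n : nat, n%:R * x <= y) -> x <= 0.
Proof.
move=> xy; rewrite leNgt; apply/negP => x0.
have y0 : 0 <= y by have := xy 0%N; rewrite mul0r.
have := archi_boundP (divr_ge0 y0 (ltW x0)).
by rewrite ltr_pdivrMr // ltNge xy.
Qed.

Lemma exponential_le_linear (R : realType) (x y : R) (c : nat) :
  0 <= x -> 0 <= y ->
  (forall n : nat, 2 ^+ n * x <= (c * n + c * n).+1%:R * y) ->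
  x <= 0.
Proof.
(* At [n + n] the hypothesis has a factor [2 ^ n * 2 ^ n] on the left: one
   factor absorbs the linear growth, the other is unbounded. *)
move=> x0 y0 xy; apply: (@nonpos_of_bounded_multiples _ _ ((4 * c + 1)%:R * y)) => n.
apply: (@le_trans _ _ (2 ^+ n * x)).
  by rewrite -natrX ler_wpM2r // ler_nat ltnW // ltn_expl.
rewrite -(ler_pM2l (_ : 0 < 2 ^+ n :> R)) ?exprn_gt0 // mulrA -exprD mulrA.
apply: le_trans (xy _) _; rewrite -natrX -natrM ler_wpM2r // ler_nat.
have : (n < 2 ^ n)%N by apply: ltn_expl.
by nia.
Qed.

(** * Necessity *)

Lemma cnorm_ge0 (R : realType) (x : R[i]) : 0 <= complex.Re `|x|.
Proof. by rewrite normc_def /= sqrtr_ge0. Qed.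

(** The norm of [R[i]] takes values in [R[i]] itself; order arguments that need
    an archimedean or totally ordered field go through its real part. *)
Lemma cnormE (R : realType) (x : R[i]) : `|x| = (complex.Re `|x|)%:C.
Proof. by rewrite normc_def. Qed.

Lemma Zring_block (R : realType) (beta : R[i]) (k : nat) (A : {fset R[i]}) :
  (forall a, a \in A -> Zring beta a) ->
  forall d, d \in block_alphabet beta k A -> Zring beta d.
Proof.
move=> AZ d /imfsetP[/= a _ ->].
have /choice[P PE] : forall i : 'I_k, exists P : {poly int},
    val (tnth a i) = (map_poly intr P).[beta].
  by move=> i; apply: AZ; apply: valP.
exists (\sum_i P i * 'X^i); rewrite rmorph_sum horner_sum; apply: eq_bigr => i _.
by rewrite rmorphM /= map_polyXn hornerM hornerXn -PE.
Qed.

Lemma mem_block (R : realType) (beta : R[i]) (k : nat) (A : {fset R[i]})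
    (a : R[i]) :
  (0 < k)%N -> 0 \in A -> a \in A -> a \in block_alphabet beta k A.
Proof.
case: k => // k _ A0 Aa; apply/imfsetP.
exists [tuple if i == ord0 then [` Aa]%fset else [` A0]%fset | i < k.+1] => //=.
by rewrite big_ord_recl big1 => [|i _]; rewrite tnth_mktuple ?mul0r //= mulr1 addr0.
Qed.

(** [beta] specializes to [gamma] when [gamma] satisfies every integer
    polynomial relation of [beta], i.e. when [beta |-> gamma] defines a ring
    morphism on [Z[beta]].  Conjugates of an algebraic [beta] and arbitrary
    images of a transcendental one are treated alike in this way. *)
Definition specializes (R : realType) (beta gamma : R[i]) : Prop :=
  forall P : {poly int},
    (map_poly intr P).[beta] = 0 -> (map_poly intr P).[gamma] = 0.

Lemma specializes_sum (R : realType) (beta gamma : R[i]) (q : {poly int})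
    (n m k : nat) (p : 'I_n -> {poly int}) :
  specializes beta gamma ->
  (map_poly intr q).[beta] * beta ^+ m =
    \sum_i (map_poly intr (p i)).[beta] * beta ^+ (k * i) ->
  (map_poly intr q).[gamma] * gamma ^+ m =
    \sum_i (map_poly intr (p i)).[gamma] * gamma ^+ (k * i).
Proof.
move=> spec; pose P := q * 'X^m - \sum_i p i * 'X^(k * i).
have PE (y : R[i]) : (map_poly intr P).[y] = (map_poly intr q).[y] * y ^+ m
    - \sum_i (map_poly intr (p i)).[y] * y ^+ (k * i).
  rewrite rmorphB rmorphM /= map_polyXn rmorph_sum /=.
  rewrite hornerD hornerN horner_sum hornerM hornerXn; congr (_ - _).
  by apply: eq_bigr => i _; rewrite rmorphM /= map_polyXn hornerM hornerXn.
move=> /eqP; rewrite -subr_eq0 -PE => /eqP/spec/eqP.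
by rewrite PE subr_eq0 => /eqP.
Qed.

(** A representation of [2 ^ l * a] of length linear in [l] specializes to a sum
    of linearly many terms, each of them bounded because [gamma] has modulus 1.
    So every digit specializes to 0, and with them the given representation
    of 1. *)
Lemma specialization_unit_circle (R : realType) (beta gamma : R[i])
    (A : {fset R[i]}) (k : nat) :
  beta != 0 ->
  (forall a, a \in A -> Zring beta a) -> 0 \in A -> Fin A beta 1 -> (0 < k)%N ->
  block_parallel_addition beta k A ->
  specializes beta gamma ->
  `|gamma| <> 1.
Proof.
move=> beta0 AZ A0 [m [n [x xE]]] k0 addA spec gamma1.
set B := block_alphabet beta k A in addA.
have gamma0 : gamma != 0 by rewrite -normr_eq0 gamma1 oner_eq0.
have AB a : a \in A -> a \in B by apply: mem_block.
have /choice[q qE] : forall d : R[i], exists P : {poly int},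
    d \in B -> d = (map_poly intr P).[beta].
  move=> d; case: (boolP (d \in B)) => [/(Zring_block AZ)[P ->]|]; first by exists P.
  by exists 0.
pose s (d : R[i]) := (map_poly intr (q d)).[gamma].
have s0 a : a \in A -> s a = 0.
  move=> Aa; have [c cE] := doubling (AB _ A0) (AB _ Aa) addA.
  (* A bound for all digits at once; their sum avoids choosing a maximum. *)
  pose M := \sum_(d : B) complex.Re `|s (val d)|.
  suff : complex.Re `|s a| <= 0 by rewrite -lecR -cnormE normr_le0 => /eqP.
  apply: (@exponential_le_linear _ _ M c) => [||l]; first exact: cnorm_ge0.
    by apply: sumr_ge0 => *; apply: cnorm_ge0.
  have [z [zl zE]] := cE l; move: (c * l)%N zl => N zl.
  (* The relation is multiplied by [beta ^ (k * N)] to clear negative powers. *)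
  have /(specializes_sum spec) :
      (map_poly intr (2 ^+ l *: q a)).[beta] * beta ^+ (k * N) =
      \sum_(i < (N + N).+1)
        (map_poly intr (q (digits z (i%:Z - N%:Z)))).[beta] * beta ^+ (k * i).
    rewrite map_polyZ hornerZ rmorphXn -qE ?AB //= -zE (laurent_value_range _ zl).
    rewrite mulr_suml; apply: eq_bigr => i _.
    rewrite -mulrA -qE; last exact: valP.
    congr (_ * _); rewrite !exprM; set b := beta ^+ k.
    by rewrite !exprnP -expfzDr ?expf_neq0 //; congr (_ ^ _); lia.
  rewrite map_polyZ hornerZ rmorphXn /= => /(congr1 Num.norm).
  rewrite !normrM !normrX gamma1 expr1n mulr1 normr_nat => sE.
  rewrite -lecR rmorphM rmorphXn rmorph_nat /= -cnormE sE.
  apply: le_trans (ler_norm_sum _ _ _) _.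
  rewrite rmorphM rmorph_nat /= mulr_natl -[X in _ *+ X]card_ord -sumr_const.
  apply: ler_sum => i _; rewrite normrM normrX gamma1 expr1n mulr1 cnormE lecR.
  rewrite /M (bigD1 (z (i%:Z - N%:Z))) //= lerDl.
  by apply: sumr_ge0 => *; apply: cnorm_ge0.
have /(specializes_sum spec) : (map_poly intr 1).[beta] * beta ^+ m =
    \sum_(i < m + n + 1)
      (map_poly intr (q (val (x (i%:Z - m%:Z))))).[beta] * beta ^+ (1 * i).
  rewrite rmorph1 hornerC [X in X * _]xE mulr_suml; apply: eq_bigr => i _.
  rewrite -mulrA -qE; last exact: AB (valP _).
  by congr (_ * _); rewrite mul1n !exprnP -expfzDr //; congr (_ ^ _); lia.
rewrite rmorph1 hornerC mul1r big1 => [|i _]; last first.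
  by rewrite -/(s _) s0 ?mul0r //; apply: valP.
by move=> /eqP; rewrite expf_eq0 (negPf gamma0) andbF.
Qed.

Lemma map_intr_rat (F : numFieldType) (P : {poly int}) :
  map_poly intr P = map_poly ratr (map_poly intr P) :> {poly F}.
Proof. by rewrite -map_poly_comp; apply: eq_map_poly => x /=; rewrite ratr_int. Qed.

Lemma block_addition_conjugates (R : realType) (beta : R[i]) (A : {fset R[i]})
    (k : nat) :
  beta != 0 ->
  (forall a, a \in A -> Zring beta a) -> 0 \in A -> Fin A beta 1 -> (0 < k)%N ->
  block_parallel_addition beta k A ->
  algebraicOver ratr beta /\ forall z : R[i], conjugate beta z -> `|z| <> 1.
Proof.
move=> beta0 AZ A0 A1 k0 addA.
have unit gamma :=
  @specialization_unit_circle R beta gamma A k beta0 AZ A0 A1 k0 addA.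
split.
  (* A transcendental [beta] specializes to anything, in particular to 1. *)
  apply: contrapT => nalg; apply: (unit 1); last exact: normr1.
  move=> P Pb; have [->|P0] := eqVneq P 0; first by rewrite rmorph0 horner0.
  case: nalg; exists (map_poly intr P); last by rewrite -map_intr_rat; apply/eqP.
  by rewrite map_poly_eq0_id0 // intr_eq0 lead_coef_eq0.
(* The minimal polynomial divides every rational relation of [beta], so [beta]
   specializes to its conjugates. *)
move=> z [p [pm pb pmin] pz]; apply: unit => P.
rewrite map_intr_rat; set Q := map_poly _ P => Qb.
have p0 := monic_neq0 pm.
suff /dvdpP[S ->] : p %| Q by rewrite rmorphM hornerM /= (eqP pz) mulr0.
rewrite /dvdp; apply: contraTT (ltn_modpN0 Q p0) => r0; rewrite -leqNgt.
apply: pmin => //; move: Qb.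
rewrite {1}(divp_eq Q p) rmorphD rmorphM hornerD hornerM /= (eqP pb) mulr0 add0r.
by move=> Qb; apply/eqP.
Qed.

(** * Root squaring *)

(** For [p] with roots [z] the product [p(X) p(-X)] is an even polynomial with
    roots [z] and [- z]; as a polynomial in [X ^ 2] it has roots [z ^ 2]. *)
Definition graeffe (F : comNzRingType) (p : {poly F}) : {poly F} :=
  even_poly (p * (p \Po - 'X)).

Lemma even_poly_compX2 (F : nzRingType) (p : {poly F}) : even_poly (p \Po 'X^2) = p.
Proof.
apply/polyP => i; rewrite coef_even_poly coef_comp_poly_Xn // -muln2.
by rewrite dvdn_mull // mulnK.
Qed.

Lemma graeffe_prod (F : comNzRingType) (c : F) (r : seq F) :
  graeffe (c *: \prod_(z <- r) ('X - z%:P)) =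
  (c ^+ 2 * (-1) ^+ size r) *: \prod_(z <- r) ('X - (z ^+ 2)%:P).
Proof.
rewrite -[RHS]even_poly_compX2 /graeffe; congr even_poly.
rewrite !comp_polyZ -!mul_polyC polyCM !rmorphXn rmorphN rmorph1 /=.
suff E : \prod_(z <- r) ('X - z%:P) * (\prod_(z <- r) ('X - z%:P) \Po - 'X) =
    (-1) ^+ size r * (\prod_(z <- r) ('X - (z ^+ 2)%:P) \Po 'X^2).
  by rewrite mulrACA -expr2 E mulrA.
elim: r => [|z r IH]; first by rewrite !big_nil !comp_polyC mulr1.
rewrite !big_cons !comp_polyM /= exprS mulrACA IH.
rewrite !comp_polyB !comp_polyX !comp_polyC rmorphXn /=; ring.
Qed.

Lemma map_graeffe (F F' : comNzRingType) (f : {rmorphism F -> F'}) (p : {poly F}) :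
  map_poly f (graeffe p) = graeffe (map_poly f p).
Proof.
have fXN : map_poly f (- 'X) = - 'X by rewrite rmorphN /= map_polyX.
rewrite /graeffe -fXN -map_comp_poly -rmorphM; apply/polyP => i.
by rewrite coef_map !coef_even_poly coef_map.
Qed.

(** Root squaring uses only ring operations on the coefficients, so it stays in
    the base field [F] although the roots live in [F']. *)
Lemma graeffe_iter (F F' : fieldType) (f : {rmorphism F -> F'}) (p : {poly F})
    (r : seq F') (c : F') (m : nat) :
  c != 0 -> map_poly f p = c *: \prod_(z <- r) ('X - z%:P) ->
  exists (q : {poly F}) (d : F'), d != 0 /\
    map_poly f q = d *: \prod_(z <- r) ('X - (z ^+ (2 ^ m))%:P).
Proof.
move=> c0 pE; elim: m => [|m [q [d [d0 qE]]]].
  by exists p, c; split=> //; rewrite pE; under [in RHS]eq_bigr do rewrite expr1.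
exists (graeffe q), (d ^+ 2 * (-1) ^+ size r); split.
  by rewrite mulf_neq0 ?expf_neq0 // oppr_eq0 oner_eq0.
rewrite map_graeffe qE.
have -> : \prod_(z <- r) ('X - (z ^+ (2 ^ m))%:P) =
    \prod_(z <- map (fun z => z ^+ (2 ^ m)) r) ('X - z%:P) by rewrite big_map.
rewrite graeffe_prod size_map big_map.
by under eq_bigr do rewrite -exprM -expnSr.
Qed.

(** * Dominance of one coefficient *)

Definition norm1 (F : numDomainType) (p : {poly F}) : F :=
  \sum_(i < size p) `|p`_i|.

Lemma norm1_wide (F : numDomainType) (p : {poly F}) (n : nat) :
  (size p <= n)%N -> norm1 p = \sum_(i < n) `|p`_i|.
Proof.
move=> pn; rewrite /norm1 (big_ord_widen n (fun i => `|p`_i|)) // big_mkcond /=.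
by apply: eq_bigr => i _; case: ltnP => // ip; rewrite nth_default ?normr0.
Qed.

Lemma norm1_ge0 (F : numDomainType) (p : {poly F}) : 0 <= norm1 p.
Proof. exact: sumr_ge0. Qed.

Lemma norm1D (F : numDomainType) (p q : {poly F}) :
  norm1 (p + q) <= norm1 p + norm1 q.
Proof.
pose n := maxn (size p) (size q).
rewrite (norm1_wide (size_polyD p q)) (@norm1_wide _ p n) ?leq_maxl //.
rewrite (@norm1_wide _ q n) ?leq_maxr // -big_split; apply: ler_sum => i _.
by rewrite coefD ler_normD.
Qed.

Lemma norm1Z (F : numDomainType) (c : F) (p : {poly F}) :
  norm1 (c *: p) = `|c| * norm1 p.
Proof.
rewrite (norm1_wide (size_scale_leq c p)) mulr_sumr; apply: eq_bigr => i _.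
by rewrite coefZ normrM.
Qed.

Lemma norm1_mulX (F : numDomainType) (p : {poly F}) : norm1 ('X * p) = norm1 p.
Proof.
have Xp : (size ('X * p)%R <= (size p).+1)%N.
  by apply: leq_trans (size_polyMleq _ _) _; rewrite size_polyX.
rewrite (norm1_wide Xp) big_ord_recl coefXM /= normr0 add0r.
by apply: eq_bigr => i _; rewrite coefXM.
Qed.

Lemma norm1_Xn (F : numDomainType) (n : nat) : norm1 ('X^n : {poly F}) = 1.
Proof.
elim: n => [|n IH]; last by rewrite exprS norm1_mulX.
by rewrite /norm1 size_poly1 big_ord1 coef1 normr1.
Qed.

Lemma bernoulli (F : realDomainType) (t : F) (n : nat) :
  0 <= t -> 1 + n%:R * t <= (1 + t) ^+ n.
Proof.
move=> t0; elim: n => [|n IH]; first by rewrite mul0r addr0.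
have n0 : 0 <= n%:R :> F by [].
rewrite exprS; apply: le_trans (ler_wpM2l _ IH); last by lra.
by rewrite -natr1; nra.
Qed.

Lemma expr_le_eps (R : realType) (x e : R) :
  0 <= x -> x < 1 -> 0 < e -> exists M, forall m, (M <= m)%N -> x ^+ m <= e.
Proof.
rewrite le_eqVlt => /predU1P[<- _|x0 x1] e0.
  by exists 1%N => m m1; rewrite expr0n -(prednK m1) ltW.
have xV1 : 1 < x^-1 by rewrite invf_gt1.
pose t := x^-1 - 1; have t0 : 0 < t by rewrite subr_gt0.
have eV : 0 < e^-1 by rewrite invr_gt0.
have := archi_boundP (ltW (divr_gt0 eV t0)).
set M := Num.Def.archi_bound _ => Mgt; exists M => m Mm.
rewrite -[e]invrK -[x]invrK exprVn lef_pV2 ?posrE ?invr_gt0 ?exprn_gt0 ?invr_gt0 //.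
have -> : x^-1 = 1 + t by rewrite /t addrC subrK.
apply: le_trans (bernoulli _ (ltW t0)).
rewrite ltr_pdivrMr // in Mgt.
have : M%:R * t <= m%:R * t by apply: ler_wpM2r; rewrite ?ler_nat // ltW.
by lra.
Qed.

Lemma normX_le_eps (R : realType) (z : R[i]) (e : R) :
  `|z| < 1 -> 0 < e -> exists M, forall m, (M <= m)%N -> `|z ^+ m| <= e%:C.
Proof.
rewrite cnormE ltcR => z1 e0.
have z0 : 0 <= complex.Re `|z| by rewrite normc_def /= sqrtr_ge0.
have [M ME] := expr_le_eps z0 z1 e0; exists M => m Mm.
by rewrite normrX cnormE -rmorphXn /= lecR ME.
Qed.

(** Up to a scalar each factor is ['X - w] or [1 - w 'X], where [w] is [z ^ m] or
    [z ^ - m], whichever is small.  Multiplying by such a factor turns a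
    polynomial within [e / 2] of ['X^s] into one within [e] of ['X^(s.+1)] or
    ['X^s] respectively, once [|w| <= e / 4]; so [s] ends up as the number of
    roots inside the unit disc. *)
Lemma dominant_monomial (R : realType) (r : seq R[i]) (e : R) :
  {in r, forall z, `|z| <> 1} -> 0 < e -> e <= 1 ->
  exists (M s : nat), forall m : nat, (M <= m)%N -> exists2 c : R[i], c != 0 &
    norm1 (c *: \prod_(z <- r) ('X - (z ^+ m)%:P) - 'X^s) <= e%:C.
Proof.
elim: r e => [|z r IH] e r1 e0 e1.
  exists 0%N, 0%N => m _; exists 1; first exact: oner_neq0.
  by rewrite big_nil scale1r expr0 subrr /norm1 size_poly0 big_ord0 lecR ltW.
have [|||M [s Ms]] := IH (e / 2); [|lra|lra|].
  by move=> y yr; apply: r1; rewrite inE yr orbT.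
have e4 : 0 < e / 4 by lra.
(* In both cases the new error is [p - w q] with [p] the old error [E] up to a
   shift and [q] the old product, of norm at most [norm1 E + 1 <= 2]. *)
have step (w : R[i]) (E p q : {poly R[i]}) :
    `|w| <= (e / 4)%:C -> norm1 E <= (e / 2)%:C ->
    norm1 p = norm1 E -> norm1 q <= norm1 E + 1 -> norm1 (p + (- w) *: q) <= e%:C.
  move=> we Ee pE qE; apply: le_trans (norm1D _ _) _.
  have q2 : norm1 q <= 2%:C.
    apply: le_trans qE _; apply: le_trans (lerD Ee (lexx 1)) _.
    by rewrite -[X in _ + X]/(1%:C) -rmorphD lecR; lra.
  have : `|- w| * norm1 q <= (e / 4)%:C * 2%:C.
    by rewrite normrN; apply: ler_pM => //; apply: norm1_ge0.
  rewrite norm1Z pE => wq; apply: le_trans (lerD Ee wq) _.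
  by rewrite -rmorphM -rmorphD lecR; lra.
have z1 : `|z| <> 1 by apply: r1; rewrite inE eqxx.
have := real_ltgtP (normr_real z) (real1 _) => -[z1' | z1' | //].
  have [M' ME] := normX_le_eps z1' e4.
  exists (maxn M M'), s.+1 => m; rewrite geq_max => /andP[Mm M'm].
  have [c c0 cE] := Ms m Mm; exists c => //; move: cE.
  rewrite big_cons; set P := \prod_(y <- r) _; set E := _ - _ => EE.
  have -> : c *: (('X - (z ^+ m)%:P) * P) - 'X^(s.+1) =
      'X * E + (- z ^+ m) *: (E + 'X^s).
    by rewrite /E exprS -!mul_polyC polyCN; ring.
  apply: step (ME _ M'm) EE (norm1_mulX _) _.
  by rewrite -(norm1_Xn R[i] s) norm1D.
have zV1 : `|z^-1| < 1 by rewrite normfV invf_lt1 // (lt_trans ltr01).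
have z0 : z != 0 by rewrite -normr_gt0 (lt_trans ltr01).
have [M' ME] := normX_le_eps zV1 e4.
exists (maxn M M'), s => m; rewrite geq_max => /andP[Mm M'm].
have [c c0 cE] := Ms m Mm; exists (- (z^-1 ^+ m * c)).
  by rewrite oppr_eq0 mulf_neq0 ?expf_neq0 ?invr_eq0.
move: cE; rewrite big_cons; set P := \prod_(y <- r) _; set E := _ - _ => EE.
have -> : - (z^-1 ^+ m * c) *: (('X - (z ^+ m)%:P) * P) - 'X^s =
    E + (- z^-1 ^+ m) *: ('X * (E + 'X^s)).
  have zz : (z^-1 ^+ m)%:P * (z ^+ m)%:P = 1 :> {poly R[i]}.
    by rewrite -polyCM -exprMn mulVf // expr1n.
  rewrite /E -!mul_polyC !polyCN polyCM mulrBl mulrBr.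
  have -> : - ((z^-1 ^+ m)%:P * c%:P) * ((z ^+ m)%:P * P) =
      - (c%:P * P) * ((z^-1 ^+ m)%:P * (z ^+ m)%:P) by ring.
  by rewrite zz; ring.
apply: step (ME _ M'm) EE (erefl _) _.
by rewrite norm1_mulX -(norm1_Xn R[i] s) norm1D.
Qed.

Lemma minimal_polynomial_exists (R : realType) (x : R[i]) :
  algebraicOver ratr x -> exists p : {poly rat}, minimal_polynomial x p.
Proof.
move=> [p0 p00 p0x].
pose P n := `[< exists q : {poly rat},
  [/\ q != 0, root (map_poly ratr q) x & size q = n] >].
have exP : exists n, P n by exists (size p0); apply/asboolP; exists p0.
have [_ /asboolP[p [p_neq0 px <-]] pmin] := ex_minnP exP.
exists ((lead_coef p)^-1 *: p).
have lp0 : (lead_coef p)^-1 != 0 by rewrite invr_eq0 lead_coef_eq0.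
split=> [||q q0 qx].
- by rewrite monicE lead_coefZ mulVf ?lead_coef_eq0.
- by rewrite map_polyZ rootZ // fmorph_eq0.
- by rewrite size_scale //; apply: pmin; apply/asboolP; exists q.
Qed.

(** With [norm1] distance to a monomial at most [1/8], the dominant coefficient
    has modulus at least [7/8] and the others together at most [1/8]; the ratio
    survives rescaling to integer coefficients, whereas the scalar itself is
    complex and unknown. *)
Lemma dominant_relation (R : realType) (beta : R[i]) :
  algebraicOver ratr beta -> (forall z : R[i], conjugate beta z -> `|z| <> 1) ->
  exists (D N : nat) (s : 'I_D) (g : 'I_D -> int),
    [/\ \sum_i (g i)%:~R * (beta ^+ N) ^+ i = 0, 0 < g s
      & 4 * \sum_(i | i != s) `|g i| <= g s].
Proof.
move=> /minimal_polynomial_exists[p pmin] conj1.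
have [pm pb _] := pmin.
have [r pE] := closed_field_poly_normal (map_poly ratr p : {poly R[i]}).
have lp0 : lead_coef (map_poly ratr p : {poly R[i]}) != 0.
  by rewrite lead_coef_map fmorph_eq0 lead_coef_eq0 monic_neq0.
have rE z : root (map_poly ratr p) z = (z \in r).
  by rewrite pE rootZ // root_prod_XsubC.
have r1 : {in r, forall z, `|z| <> 1}.
  by move=> z zr; apply: conj1; exists p; rewrite ?rE.
have [||M [s Ms]] := @dominant_monomial R r (1 / 8) r1; [lra|lra|].
(* Root squaring reaches only the exponents [2 ^ M]; [2 ^ M >= M] is enough. *)
have [c c0] := Ms (2 ^ M)%N (ltnW (ltn_expl M (isT : 1 < 2)%N)).
have [q [d [d0 qE]]] := graeffe_iter M lp0 pE.
have [G [a a0 GE]] := rat_poly_scale q.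
set Pr := \prod_(z <- r) _ in qE *.
pose k : R[i] := c * d^-1 * (ratr a%:~R^-1).
have k0 : k != 0.
  apply: mulf_neq0; first by rewrite mulf_neq0 ?invr_eq0.
  by rewrite fmorph_eq0 invr_eq0 intr_eq0.
have PrE : c *: Pr = k *: map_poly intr G.
  have <- : d^-1 *: map_poly ratr q = Pr by rewrite qE scalerA mulVf // scale1r.
  by rewrite GE map_polyZ (map_intr_rat R[i]) !scalerA.
rewrite PrE; set E := _ - _ => Esmall.
pose D := maxn (size E) s.+1.
have sD : (s < D)%N by rewrite leq_maxr.
have GD : (size (map_poly intr G : {poly R[i]}) <= D)%N.
  rewrite -(size_scale _ k0) -[_ *: _](subrK 'X^s) -/E.
  by apply: leq_trans (size_polyD _ _) _; rewrite size_polyXn.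
pose t := Ordinal sD.
have kG (i : 'I_D) : i != t -> `|E`_i| = `|k| * (`|G`_i|)%:~R.
  move=> it; rewrite coefB coefXn (_ : (i == s :> nat) = false); last exact: negPf it.
  by rewrite subr0 coefZ coef_map normrM /= -intr_norm.
have kGs : `|E`_t| >= 1 - `|k| * (`|G`_s|)%:~R.
  rewrite coefB coefXn eqxx coefZ coef_map /= intr_norm -normrM distrC.
  by apply: le_trans (lerB_dist _ _); rewrite normr1.
pose S := \sum_(i < D | i != t) `|G`_i|.
have Esum : `|k| * S%:~R + `|E`_t| <= (1 / 8)%:C.
  apply: le_trans Esmall; rewrite (@norm1_wide _ E D) ?leq_maxl // (bigD1 t) //= addrC.
  apply: lerD => //; rewrite /S rmorph_sum mulr_sumr /=.
  by apply: ler_sum => i it; rewrite kG.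
have k_gt0 : 0 < `|k| by rewrite normr_gt0.
have intrC (m : int) : m%:~R = (m%:~R)%:C :> R[i] by rewrite rmorph_int.
have Ssmall : `|k| * S%:~R <= (1 / 8)%:C by apply: le_trans Esum; rewrite lerDl.
have Gs_big : 1%:C <= (1 / 8)%:C + `|k| * (`|G`_s|)%:~R.
  rewrite -lerBlDr; apply: le_trans kGs _; apply: le_trans Esum.
  by rewrite lerDr mulr_ge0 // ler0z sumr_ge0.
have {Ssmall Gs_big} Gdom : 4 * S < `|G`_s|.
  have [kappa kE] : exists kappa : R, `|k| = kappa%:C by eexists; apply: cnormE.
  move: k_gt0 Ssmall Gs_big; rewrite kE ltcR !intrC -!rmorphM -rmorphD /= !lecR.
  move=> kappa0 Ssmall Gs_big.
  rewrite -(ltr_int R) -(ltr_pM2l kappa0) rmorphM /=; lra.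
have sg0 : G`_s != 0.
  by rewrite -normr_gt0; apply: le_lt_trans Gdom; rewrite mulr_ge0 ?sumr_ge0.
have sgE : sgz G`_s * G`_s = `|G`_s| by rewrite -abszEsg abszE.
have sgG x : `|sgz G`_s * x| = `|x| by rewrite normrM normr_sgz sg0 mul1r.
(* The sign makes the dominant coefficient positive. *)
exists D, (2 ^ M)%N, t, (fun i => sgz G`_s * G`_i); split.
- have : (map_poly intr G).[beta ^+ (2 ^ M)] = 0.
    apply/eqP; rewrite -[_ == _]/(root _ _) -(rootZ _ _ k0) -PrE rootZ //.
    have -> : Pr = \prod_(z <- map (fun z => z ^+ (2 ^ M)) r) ('X - z%:P).
      by rewrite big_map.
    by rewrite root_prod_XsubC; apply: map_f; rewrite -rE.
  rewrite (horner_coef_wide _ GD) => /(congr1 ( *%R (sgz G`_s)%:~R)).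
  rewrite mulr0 => G0; apply: etrans G0.
  by rewrite mulr_sumr; apply: eq_bigr => i _; rewrite coef_map rmorphM /= mulrA.
- by rewrite sgE normr_gt0.
- by rewrite sgE; under eq_bigr do rewrite sgG; exact: ltW.
Qed.

(** * Parallel addition from a dominant coefficient *)

Definition int_alphabet (R : realType) (a : nat) : {fset R[i]} :=
  [fset ((nat_of_ord i)%:Z - a%:Z)%:~R | i : 'I_(a + a).+1]%fset.

Lemma int_alphabetP (R : realType) (a : nat) (x : R[i]) :
  reflect (exists2 n : int, (`|n| <= a)%N & x = n%:~R) (x \in int_alphabet R a).
Proof.
apply: (iffP (imfsetP _ _ _ _)) => /= [[i _ ->]|]; [|case=> n na ->].
  by exists ((i : nat)%:Z - a%:Z) => //; have := ltn_ord i; lia.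
have ia : (`|(n + a%:Z)%R|%N < (a + a).+1)%N by lia.
by exists (Ordinal ia) => //=; congr _%:~R; lia.
Qed.

(** Recovers an integer from its image in [R[i]]; the floor is one convenient
    left inverse of the embedding among others. *)
Definition to_int (R : realType) (x : R[i]) : int := Num.floor (complex.Re x).

Lemma to_intK (R : realType) (n : int) : to_int (n%:~R : R[i]) = n.
Proof.
have -> : (n%:~R : R[i]) = (n%:~R)%:C by rewrite rmorph_int.
by rewrite /to_int /= intrKfloor.
Qed.

Lemma sum_int_alphabet (R : realType) (a : nat) (x : R[i]) :
  x \in sum_alphabet (int_alphabet R a) ->
  x = (to_int x)%:~R /\ (`|to_int x| <= a + a)%N.
Proof.
move=> /imfset2P[y /int_alphabetP[m ma yE] [z /int_alphabetP[n na zE] xE]].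
rewrite xE yE zE -rmorphD to_intK; split=> //; lia.
Qed.

(** Rounding towards zero keeps the quotient of 0 equal to 0 and bounds it by
    the quotient of absolute values, for either sign of [x]. *)
Definition trunc_div (d x : int) : int := sgz x * (`|x| %/ d)%Z.

Lemma trunc_div0 (d : int) : trunc_div d 0 = 0.
Proof. by rewrite /trunc_div sgz0 mul0r. Qed.

Lemma trunc_div_rem (d x : int) : 0 < d -> `|x - d * trunc_div d x| <= d.
Proof.
move=> d0; rewrite /trunc_div {1}[x]intEsg mulrCA -mulrBr normrM normr_sgz.
have [->|x0] := eqVneq x 0; first by rewrite mul0r ltW.
rewrite mul1r abszE mulrC {1}(divz_eq `|x| d) addrC addKr.
rewrite ger0_norm ?modz_ge0 ?gt_eqF //.
by rewrite ltW // ltz_pmod.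
Qed.

Lemma trunc_div_le (d x : int) (m : int) :
  0 < d -> 0 <= m -> `|x| <= m * d -> `|trunc_div d x| <= m.
Proof.
move=> d0 m0 xm; rewrite /trunc_div normrM normr_sgz.
have [_|x0] := eqVneq x 0; first by rewrite mul0r.
rewrite mul1r ger0_norm ?divz_ge0 // -(ler_pM2r d0); apply: le_trans xm.
by rewrite lez_floor // gt_eqF.
Qed.

Lemma block_alphabet1 (R : realType) (beta : R[i]) (A : {fset R[i]}) :
  block_alphabet beta 1 A = A.
Proof.
apply/fsetP => x; apply/imfsetP/idP => /=; [case=> a _ ->|move=> Ax].
  by rewrite big_ord1 mulr1; apply: valP.
by exists [tuple [` Ax]%fset] => //; rewrite big_ord1 mulr1.
Qed.

(** Write [B = g s] and [S] for the sum of the other [|g i|], so [4 S <= B].  From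
    each digit [x_j] take the quotient [q_j] of [x_j] by [B] and subtract [q_j]
    times the relation, placed so that [B] falls on position [j].  Position [j]
    keeps a remainder of modulus at most [B] and receives carries of modulus at
    most [S max |q|].  With [|q| <= 4] the result is at most [a = B + 4 S], and
    conversely digits up to [2 a = 2 B + 8 S <= 4 B] have quotients at most 4. *)
Lemma dominant_parallel_addition (R : realType) (beta : R[i]) (D N : nat)
    (s : 'I_D) (g : 'I_D -> int) :
  beta != 0 -> \sum_i (g i)%:~R * (beta ^+ N) ^+ i = 0 -> 0 < g s ->
  4 * \sum_(i | i != s) `|g i| <= g s ->
  exists a : nat, (0 < a)%N /\ parallel_addition beta (int_alphabet R a).
Proof.
move=> beta0 g0 gs0 gdom; set S := \sum_(i | _) _ in gdom.
have S0 : 0 <= S by apply: sumr_ge0.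
pose a := `|(g s + 4 * S)%R|%N.
have aE : a%:Z = g s + 4 * S by rewrite /a; lia.
exists a; split; first by lia.
set A := int_alphabet R a.
have A0 : 0 \in A by apply/int_alphabetP; exists 0.
(* The default 0 is never reached on the integers [Z w j], by [Za] below. *)
pose code (n : int) : A := insubd [` A0]%fset n%:~R.
have codeE n : `|n| <= a%:Z -> val (code n) = n%:~R.
  by move=> na; rewrite /code insubdK //; apply/int_alphabetP; exists n => //; lia.
pose Q (x : sum_alphabet A) : int := trunc_div (g s) (to_int (val x)).
(* Coefficient [i] of the relation meets position [j] from position [j + h i]. *)
pose h (i : 'I_D) : int := (N * s)%:Z - (N * i)%:Z.
pose Z (w : int -> sum_alphabet A) (j : int) : int :=
  to_int (val (w j)) - \sum_i g i * Q (w (j + h i)).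
have Q4 x : `|Q x| <= 4.
  apply: trunc_div_le => //; have [_] := sum_int_alphabet (valP x).
  by rewrite -lez_nat abszE; lia.
have Za w j : `|Z w j| <= a%:Z.
  rewrite /Z (bigD1 s) //= {1}/h subrr addr0 opprD addrA aE.
  apply: le_trans (ler_normB _ _) _; apply: lerD; first exact: trunc_div_rem.
  apply: le_trans (ler_norm_sum _ _ _) _; rewrite mulr_sumr; apply: ler_sum => i _.
  by rewrite normrM mulrC ler_wpM2r.
pose phi (w : int -> sum_alphabet A) (j : int) := code (Z w j).
exists phi; split; last first.
  exists (N * D + N * s + 1)%N, (N * D)%N, (N * s)%N; split=> //.
  have x00 : (0 + 0 : R[i]) \in sum_alphabet A by apply: in_imfset2.
  pose x0 : sum_alphabet A := [` x00]%fset.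
  (* The window starts at [j + N s], so entry [k] is position [j + N s - k]:
     entry [N s] is [j] itself and entry [N i] is [j + h i]. *)
  exists (fun T => code (to_int (val (nth x0 T (N * s))) -
                         \sum_(i < D) g i * Q (nth x0 T (N * i)))) => w j.
  have nthE k : (k < N * D + N * s + 1)%N -> forall d, d = j + (N * s)%:Z - k%:Z ->
      nth x0 [tuple w (j + (N * s)%:Z - (i : nat)%:Z) | i < N * D + N * s + 1] k = w d.
    by move=> kp d ->; rewrite -[k]/(val (Ordinal kp)) -tnth_nth tnth_mktuple.
  congr (code (to_int (val _) - _)); first by rewrite (nthE _ _ j) //; lia.
  apply: eq_bigr => i _; congr (_ * Q _); rewrite (nthE _ _ (j + h i)) //.
    by have := ltn_ord i; nia.
  by rewrite /h; lia.
move=> w /(@finite_support_bounded _ (digits w))[K wK].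
pose q (j : int) : R[i] := (Q (w j))%:~R.
have qK : supported K q.
  move=> j Kj; rewrite /q /Q -/(digits w j) wK //.
  by rewrite -[0]/(0%:~R) to_intK trunc_div0.
pose L := (K + N * D)%N.
have uL i : supported L (fun j => - (g i)%:~R * q (j + h i)).
  move=> j Lj; rewrite (supported_shift (h := h i) qK) ?mulr0 //.
  apply: leq_ltn_trans Lj; rewrite leq_add2l /h.
  by have := ltn_ord i; have := ltn_ord s; nia.
have phiE : digits (phi w) = fun j => digits w j + \sum_i - (g i)%:~R * q (j + h i).
  apply/funext => j; rewrite /digits codeE // rmorphB rmorph_sum /= -sumrN.
  have [<- _] := sum_int_alphabet (valP (w j)).
  by congr (_ + _); apply: eq_bigr => i _; rewrite rmorphM mulNr.
have wL : supported L (digits w) by apply: supported_widen wK; apply: leq_addr.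
have sL : supported L (fun j => \sum_i - (g i)%:~R * q (j + h i)).
  by move=> j Lj; rewrite big1 // => i _; apply: uL.
split.
  apply: (@supported_finite _ L (digits (phi w))); rewrite phiE => j Lj.
  by rewrite wL // sL // addr0.
rewrite -[LHS]/(laurent_value beta (digits w)).
rewrite -[RHS]/(laurent_value beta (digits (phi w))).
rewrite phiE (laurent_valueD beta wL sL) (laurent_value_sum beta uL).
rewrite -[LHS]addr0; congr (_ + _); apply/esym.
under eq_bigr => i _ do rewrite laurent_valueZ laurent_value_shift //.
have E i : - (g i)%:~R * (beta ^ (- h i) * laurent_value beta q) =
    - (beta ^ (- (N * s)%:Z) * laurent_value beta q) * ((g i)%:~R * (beta ^+ N) ^+ i).
  by rewrite /h opprB addrC expfzDr // -exprnP exprM; ring.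
by under eq_bigr do rewrite E; rewrite -mulr_sumr g0 mulr0.
Qed.

(** * The characterization *)

Lemma algebraic_int_alphabet (R : realType) (beta : R[i]) :
  beta != 0 -> algebraicOver ratr beta ->
  (forall z : R[i], conjugate beta z -> `|z| <> 1) ->
  exists A : {fset R[i]},
    [/\ forall a : R[i], a \in A -> exists n : int, a = n%:~R,
        0 \in A,
        Fin A beta 1
      & block_parallel_addition beta 1 A].
Proof.
move=> beta0 balg bconj.
have [D [N [s [g [g0 gs gdom]]]]] := dominant_relation balg bconj.
have [a [a0 addA]] := dominant_parallel_addition beta0 g0 gs gdom.
have A1 : 1 \in int_alphabet R a by apply/int_alphabetP; exists 1.
exists (int_alphabet R a); split.
- by move=> x /int_alphabetP[n _ ->]; exists n.
- by apply/int_alphabetP; exists 0.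
- exists 0%N, 0%N, (fun=> [` A1]%fset).
  by rewrite big_ord1 subrr expr0z mulr1.
- by rewrite /block_parallel_addition block_alphabet1.
Qed.

Unset Implicit Arguments.

Theorem theorem4p2 (R : realType) (beta : R[i]) (hbeta : 1 < `|beta|) :
  ((exists (A : {fset R[i]}) (k : nat),
      [/\ forall a : R[i], a \in A -> Zring beta a,
          0 \in A,
          Fin A beta 1,
          (0 < k)%N
        & block_parallel_addition beta k A])
   <->
   (algebraicOver ratr beta /\
    forall z : R[i], conjugate beta z -> `|z| <> 1))
  /\
  ((algebraicOver ratr beta /\
    forall z : R[i], conjugate beta z -> `|z| <> 1) ->
   exists A : {fset R[i]},
     [/\ forall a : R[i], a \in A -> exists n : int, a = n%:~R,
         0 \in A,
         Fin A beta 1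
       & block_parallel_addition beta 1 A]).
Proof.
have beta0 : beta != 0 by rewrite -normr_gt0 (lt_trans ltr01).
split; last by move=> [balg bconj]; apply: algebraic_int_alphabet.
split=> [[A [k [AZ A0 A1 k0 addA]]]|[balg bconj]].
  exact: (block_addition_conjugates beta0 AZ A0 A1 k0 addA).
have [A [AZ A0 A1 addA]] := algebraic_int_alphabet beta0 balg bconj.
exists A, 1%N; split=> // a /AZ[n ->]; exists n%:P.
by rewrite map_polyC hornerC.
Qed.
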